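(* Let $Y\in\mathcal{G}$ and let $W_n^Y$ be the probabilistic Fubini numbers associated with $Y$. For $n\ge1$, $$W_n^Y=n!\,\det\left(a_{ij}\right)_{1\le i,j\le n},\qquad a_{ij}=\begin{cases}(-1)^{i-j}\dfrac{\mathbb{E}[Y^{i-j+1}]}{(i-j+1)!}, & j\le i,\\[2mm] 1, & j=i+1,\\ 0, & j>i+1,\end{cases}$$ that is, $$W_n^Y=n!\begin{vmatrix}\frac{\mathbb{E}Y}{1!}&1&0&\cdots&0\\ -\frac{\mathbb{E}Y^2}{2!}&\frac{\mathbb{E}Y}{1!}&1&\cdots&0\\ \vdots&\vdots&\vdots&\ddots&\vdots\\ (-1)^{n-2}\frac{\mathbb{E}Y^{n-1}}{(n-1)!}&(-1)^{n-3}\frac{\mathbb{E}Y^{n-2}}{(n-2)!}&(-1)^{n-4}\frac{\mathbb{E}Y^{n-3}}{(n-3)!}&\cdots&1\\ (-1)^{n-1}\frac{\mathbb{E}Y^n}{n!}&(-1)^{n-2}\frac{\mathbb{E}Y^{n-1}}{(n-1)!}&(-1)^{n-3}\frac{\mathbb{E}Y^{n-2}}{(n-2)!}&\cdots&\frac{\mathbb{E}Y}{1!}\end{vmatrix}.$$ Moreover, $$W_n^Y=n!\sum_{l_1+2l_2+\cdots+nl_n=n}\binom{l_1+\cdots+l_n}{l_1,\dots,l_n}\left(\frac{\mathbb{E}Y}{1!}\right)^{l_1}\left(\frac{\mathbb{E}Y^2}{2!}\right)^{l_2}\cdots\left(\frac{\mathbb{E}Y^n}{n!}\right)^{l_n},$$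 where the sum is over all nonnegative integers $l_1,\dots,l_n$ with $l_1+2l_2+\cdots+nl_n=n$ and $\binom{l_1+\cdots+l_n}{l_1,\dots,l_n}$ is the multinomial coefficient.
   Context: $\mathbb{N}_0=\{0,1,2,\dots\}$. $\mathcal{G}$ is the set of real random variables $Y$ such that $\mathbb{E}|Y|^n<\infty$ for all $n\in\mathbb{N}_0$ and, for some $r>0$, $\lim_{n\to\infty}|t|^n\mathbb{E}|Y|^n/n!=0$ for all $|t|<r$. Let $Y_1,Y_2,\dots$ be i.i.d. copies of $Y$, $S_0=0$ and $S_i=Y_1+\cdots+Y_i$ for $i\ge1$ (convention $0^0=1$). The probabilistic Stirling numbers of the second kind are $S_Y(n,k)=\frac{1}{k!}\sum_{j=0}^k(-1)^{k-j}\binom{k}{j}\mathbb{E}S_j^n$, and the probabilistic Fubini numbers are $$W_n^Y=\sum_{k=0}^n S_Y(n,k)\,k!.$$ They are the values at $x=1$ of the probabilistic Fubini polynomials $W_n^Y(x)=\sum_{i=0}^\infty\mathbb{E}[S_i^n]\frac{1}{1+x}\left(\frac{x}{1+x}\right)^i$. *)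

(* Defs.v *)
From HB Require Import structures.
From mathcomp Require Import all_boot all_order all_algebra.
From mathcomp Require Import all_classical all_reals all_analysis.

Set Implicit Arguments.
Unset Strict Implicit.
Unset Printing Implicit Defensive.

Import Order.TTheory GRing.Theory Num.Theory.
Import numFieldNormedType.Exports.

Local Open Scope classical_set_scope.
Local Open Scope ring_scope.

Section Moments.
Context (d : measure_display) (T : measurableType d) (R : realType)
  (P : probability T R).

(* [fine] sends infinite values to 0; the moments below are only used for
   variables all of whose absolute moments are finite. *)
Definition moment (X : T -> R) (n : nat) : R :=
  fine 'E_P[fun w => (X w ^+ n)%R]%E.

Definition abs_moment (X : T -> R) (n : nat) : R :=
  fine 'E_P[fun w => (`|X w| ^+ n)%R]%E.

Definition calG (Y : {RV P >-> R}) : Prop :=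
  (forall n : nat, ('E_P[fun w => (`|Y w| ^+ n)%R] < +oo)%E) /\
  (exists2 r : R, 0 < r & forall t : R, `|t| < r ->
     (fun n : nat => `|t| ^+ n * abs_moment Y n / n`!%:R) @ \oo --> (0 : R)).

Definition mutually_independent (X : nat -> {RV P >-> R}) : Prop :=
  forall (s : seq nat) (B : nat -> set R),
    uniq s -> (forall i, measurable (B i)) ->
    P (\bigcap_(i in [set` s]) (X i @^-1` B i)) =
    (\prod_(i <- s) P (X i @^-1` B i))%E.

(* The sequence is indexed from 0: [Ys i] stands for Y_(i+1), so that
   S_i = Y_1 + ... + Y_i is the sum of the first i terms and S_0 = 0. *)
Definition partial_sum (Ys : nat -> {RV P >-> R}) (i : nat) (w : T) : R :=
  \sum_(j < i) Ys j w.

Definition prob_stirling2 (Ys : nat -> {RV P >-> R}) (n k : nat) : R :=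
  (k`!%:R)^-1 *
  \sum_(j < k.+1) (-1) ^+ (k - j) * 'C(k, j)%:R * moment (partial_sum Ys j) n.

Definition prob_fubini (Ys : nat -> {RV P >-> R}) (n : nat) : R :=
  \sum_(k < n.+1) prob_stirling2 Ys n k * k`!%:R.

End Moments.

(* The copies may live on another probability space than Y, since the space
   carrying Y need not be rich enough to carry an i.i.d. sequence. *)
Definition iid_copies (R : realType)
    (d : measure_display) (T : measurableType d) (P : probability T R)
    (d' : measure_display) (T' : measurableType d') (P' : probability T' R)
    (Y : {RV P >-> R}) (Ys : nat -> {RV P' >-> R}) : Prop :=
  mutually_independent Ys /\
  (forall (i : nat) (A : set R), measurable A ->
     distribution P' (Ys i) A = distribution P Y A).

Definition multinomial (R : realType) (n : nat) (l : 'I_n -> nat) : R :=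
  (\sum_(i < n) l i)%N`!%:R / \prod_(i < n) (l i)`!%:R.

(* The entries depend on i - j only, hence are unchanged when rows and columns
   are numbered from 0. *)
Definition fubini_matrix (R : realType) (m : nat -> R) (n : nat) : 'M[R]_n :=
  \matrix_(i < n, j < n)
    if (j <= i)%N then (-1) ^+ (i - j) * m (i - j).+1 / ((i - j).+1)`!%:R
    else if j == i.+1 :> nat then 1 else 0.

(* Main.v *)
From HB Require Import structures.
Require Import Defs.
From mathcomp Require Import all_boot all_order all_algebra.
From mathcomp Require Import all_classical all_reals all_analysis.
From mathcomp Require Import measurable_realfun ring.

(** Write [c_k = E[Y^k] / k!] and, for a fixed [n], let
    [B = c_1 X + ... + c_n X^n] be the moment generating series of [Y] without
    its constant term [c_0 = 1], cut off at degree [n]. Independence of [S_j]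
    and [Y_(j+1)] gives
    [E[S_(j+1)^n] = \sum_i C(n, i) E[S_j^(n-i)] E[Y^i]], so that
    [E[S_j^n] / n!] is the coefficient of [X^n] in [(1 + B)^j]
    ([binomial_convolution_coef]). The alternating sum that defines
    [k! S_Y(n, k)] is then the binomial expansion of [((1 + B) - 1)^k], hence
    [W_n^Y / n!] is the coefficient of [X^n] in the geometric sum
    [1 + B + ... + B^n] ([prob_fubini_coef]). Both formulas of the theorem read
    off this coefficient.

    Determinant: up to degree [n] the geometric sum is the inverse of [1 - B].
    The coefficients of the inverse of a power series solve a triangular
    Toeplitz system, and Cramer's rule writes the last one as a minor of that
    system, which is a Hessenberg determinant ([convolution_inverse_det]).
    Replacing [X] by [-X] puts the signs where the theorem has them.

    Sum over [l]: expand every [B^k] by the multinomial theorem and collect the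
    monomials of degree [n] ([geometric_coef_multinomial]); the degree forces
    [l_1 + ... + l_n <= n], so every exponent vector occurs for exactly one of
    the powers [B^0, ..., B^n].

    The analytic part is the passage from independence of events to moments.
    The law of [(S_j, Y_(j+1))], restricted to an event of the later
    variables, is identified on rectangles, which determine a finite measure on
    the plane ([pair_indep_event]); an induction on [j] makes [S_j] independent
    of the later variables ([partial_sum_indep_future]). The joint law of [S_j]
    and [Y_(j+1)] is therefore a product measure, and Fubini's theorem gives
    both the integrability and the value of the mixed moments
    ([indep_integral_mul]). *)

Set Implicit Arguments.
Unset Strict Implicit.

Import Order.TTheory GRing.Theory Num.Theory.
Import numFieldNormedType.Exports.

Local Open Scope ring_scope.

(** * Independence *)

Section Probability.
Local Open Scope classical_set_scope.

Section Independence.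
Context {d : measure_display} {T : measurableType d} {R : realType}.
Variable P : probability T R.

Definition indep_RV (X Z : T -> R) : Prop :=
  forall A B : set R, measurable A -> measurable B ->
  P (X @^-1` A `&` Z @^-1` B) = (P (X @^-1` A) * P (Z @^-1` B))%E.

(** The two finite measures [E |-> P((X, Z) \in E, F)] and
    [E |-> P((X, Z) \in E) P(F)] agree on rectangles, which are stable under
    intersection and generate the measurable sets of the plane. With [E] the preimage
    of a set by addition, this shows that [X + Z] is independent of [F]. *)
Lemma pair_indep_event (X Z : T -> R) (F : set T) :
  measurable_fun setT X -> measurable_fun setT Z -> measurable F ->
  (forall A B : set R, measurable A -> measurable B ->
     P ((X @^-1` A `&` Z @^-1` B) `&` F) =
     (P (X @^-1` A `&` Z @^-1` B) * P F)%E) ->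
  forall E : set (R * R), measurable E ->
    P ((fun t => (X t, Z t)) @^-1` E `&` F) =
    (P ((fun t => (X t, Z t)) @^-1` E) * P F)%E.
Proof.
move=> mX mZ mF hF E mE.
have mXZ : measurable_fun setT (fun t => (X t, Z t)).
  by apply/measurable_fun_pairP; split.
pose XZ : {mfun T >-> (R * R)%type} :=
  HB.pack (fun t => (X t, Z t)) (isMeasurableFun.Build _ _ _ _ _ mXZ).
have PF0 : 0 <= fine (P F) by exact: fine_ge0.
pose m2 : {measure set (R * R)%type -> \bar R} :=
  mscale (NngNum PF0) (distribution P XZ).
have PFE : (fine (P F))%:E = P F by rewrite fineK ?fin_num_measure.
suff : pushforward (mrestr P mF) XZ E = m2 E.
  by rewrite /m2 /= /mscale /= PFE /pushforward /mrestr muleC.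
pose G : set (set (R * R)) :=
  [set A `*` B | A in measurable & B in measurable].
apply: (measure_unique G (fun=> setT)) => //.
- exact: measurable_prod_measurableType.
- move=> _ _ [A1 mA1 [B1 mB1 <-]] [A2 mA2 [B2 mB2 <-]].
  rewrite -setXI; exists (A1 `&` A2); first exact: measurableI.
  by exists (B1 `&` B2) => //; exact: measurableI.
- by move=> _; exists setT => //; exists setT => //; rewrite setXTT.
- by rewrite bigcup_const.
- move=> _ [A mA [B mB <-]].
  by rewrite /m2 /= /mscale /= PFE /pushforward /mrestr muleC; exact: hF.
- move=> _; rewrite /= /pushforward /mrestr preimage_setT setTI.
  by rewrite ltey_eq fin_num_measure.
Qed.

(** Independence says that the law of [(X, Z)] is the product of the laws of
    [X] and [Z]; integrability of the product, as well as its integral, then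
    come from Tonelli and Fubini on the plane. *)
Lemma indep_integral_mul (X Z : T -> R) :
  indep_RV X Z ->
  P.-integrable setT (EFin \o X) -> P.-integrable setT (EFin \o Z) ->
  P.-integrable setT (fun t => (X t * Z t)%:E) /\
  (\int[P]_t (X t * Z t)%:E = (\int[P]_t (X t)%:E) * (\int[P]_t (Z t)%:E))%E.
Proof.
move=> hXZ iX iZ.
have mX : measurable_fun setT X by apply/measurable_EFinP/(measurable_int P).
have mZ : measurable_fun setT Z by apply/measurable_EFinP/(measurable_int P).
have mXZ : measurable_fun setT (fun t => (X t, Z t)).
  by apply/measurable_fun_pairP; split.
pose XZ : {mfun T >-> (R * R)%type} :=
  HB.pack (fun t => (X t, Z t)) (isMeasurableFun.Build _ _ _ _ _ mXZ).
pose X' : {mfun T >-> R} := HB.pack X (isMeasurableFun.Build _ _ _ _ _ mX).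
pose Z' : {mfun T >-> R} := HB.pack Z (isMeasurableFun.Build _ _ _ _ _ mZ).
pose dX : probability R R := distribution P X'.
pose dZ : probability R R := distribution P Z'.
pose f : R * R -> \bar R := fun p => (p.1 * p.2)%:E.
have mf : measurable_fun [set: R * R] f.
  by apply/measurable_EFinP; apply: measurable_funM;
    [exact: measurable_fst|exact: measurable_snd].
have mE : measurable_fun [set: R] (EFin : R -> \bar R).
  by apply/measurable_EFinP; exact: measurable_id.
have joint E : measurable E -> (dX \x dZ)%E E = distribution P XZ E.
  by apply: product_measure_unique => A B mA mB; exact: hXZ.
have iX' : dX.-integrable setT (EFin : R -> \bar R).
  by apply: integrable_pushforward => //; rewrite preimage_setT.
have iZ' : dZ.-integrable setT (EFin : R -> \bar R).
  by apply: integrable_pushforward => //; rewrite preimage_setT.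
move/integrableP : (iZ') => [_ fZ]; move/integrableP : (iX') => [_ fX].
have if_ : (dX \x dZ)%E.-integrable setT f.
  apply/integrable12ltyP => //.
  under eq_integral => x _.
    under eq_integral => y _ do rewrite /f /= normrM EFinM.
    rewrite ge0_integralZl//; last exact: measurableT_comp.
    over.
  rewrite /= ge0_integralZr//; [|exact: measurableT_comp|exact: integral_ge0].
  by rewrite lte_mul_pinfty// ?integral_ge0// ge0_fin_numE// integral_ge0.
have iXZ : P.-integrable setT (f \o XZ).
  apply/integrableP; split; first exact: measurableT_comp.
  rewrite -(@ge0_integral_distribution _ _ _ _ _ _ XZ (abse \o f))//=; last first.
    exact: measurableT_comp.
  rewrite (eq_measure_integral (dX \x dZ)%E) => [|A mA _]; last exact/esym/joint.
  by case/integrableP : if_.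
split; first exact: iXZ.
have -> : (\int[P]_t (X t * Z t)%:E = \int[distribution P XZ]_p f p)%E.
  by rewrite integral_distribution.
rewrite (eq_measure_integral (dX \x dZ)%E) => [|A mA _]; last exact/esym/joint.
rewrite -integral12_prod_meas1 //.
have -> : (\int[P]_t (X t)%:E = \int[dX]_x x%:E)%E.
  by rewrite integral_distribution.
have -> : (\int[P]_t (Z t)%:E = \int[dZ]_x x%:E)%E.
  by rewrite integral_distribution.
have /fineK <- := integrable_fin_num measurableT iZ'.
rewrite -integralZr//; apply: eq_integral => x _.
rewrite fineK; last exact: (integrable_fin_num measurableT iZ').
by rewrite -integralZl.
Qed.

Lemma indep_RV_comp (X Z : T -> R) (f g : R -> R) :
  measurable_fun setT f -> measurable_fun setT g ->
  indep_RV X Z -> indep_RV (f \o X) (g \o Z).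
Proof.
move=> mf mg hXZ A B mA mB; apply: (hXZ (f @^-1` A) (g @^-1` B)).
- by rewrite -[X in measurable X]setTI; exact: mf.
- by rewrite -[X in measurable X]setTI; exact: mg.
Qed.

Variable Ys : nat -> {RV P >-> R}.

Lemma measurable_partial_sum k : measurable_fun setT (partial_sum Ys k).
Proof. by apply: measurable_sum => i. Qed.

Lemma partial_sumS k t : partial_sum Ys k.+1 t = partial_sum Ys k t + Ys k t.
Proof. by rewrite /partial_sum big_ord_recr. Qed.

Hypothesis indep : mutually_independent Ys.

Lemma bigcap_cons_preimage (k : nat) (s : seq nat) (B : nat -> set R) :
  \bigcap_(i in [set` k :: s]) (Ys i @^-1` B i) =
  Ys k @^-1` B k `&` \bigcap_(i in [set` s]) (Ys i @^-1` B i).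
Proof. by rewrite !bigcap_seq big_cons. Qed.

(** The induction on [k] needs the whole future: to add [Ys k] to [S_k],
    the pair [(S_k, Ys k)] has to be independent of the event [F] of the later
    variables, and this uses the induction hypothesis for the intersection of
    [F] with a condition on [Ys k]. *)
Lemma partial_sum_indep_future k (s : seq nat) (B : nat -> set R) :
  uniq s -> all (leq k) s -> (forall i, measurable (B i)) ->
  forall A : set R, measurable A ->
  P (partial_sum Ys k @^-1` A `&` \bigcap_(i in [set` s]) (Ys i @^-1` B i)) =
  (P (partial_sum Ys k @^-1` A) *
   P (\bigcap_(i in [set` s]) (Ys i @^-1` B i)))%E.
Proof.
elim: k s B => [|k IH] s B us ks mB A mA.
  have -> : partial_sum Ys 0 = cst 0.
    by apply/funext => t; rewrite /partial_sum big_ord0.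
  rewrite preimage_cst; case: ifP => _.
    by rewrite setTI probability_setT mul1e.
  by rewrite set0I measure0 mul0e.
set F := \bigcap_(i in _) _.
have mF : measurable F.
  by apply: bigcap_measurableType => i _; exact: measurable_funPTI.
have ks' : k \notin s.
  by apply: contraTN ks => sk; apply/allPn; exists k; rewrite // ltnn.
have split_event A1 B1 : measurable A1 -> measurable B1 ->
    P (partial_sum Ys k @^-1` A1 `&` (Ys k @^-1` B1 `&` F)) =
    (P (partial_sum Ys k @^-1` A1) * (P (Ys k @^-1` B1) * P F))%E.
  move=> mA1 mB1.
  (* [k] is not in [s], so a condition on [Ys k] extends the family [B]. *)
  pose B' i := if i == k then B1 else B i.
  have mB' i : measurable (B' i) by rewrite /B'; case: ifP.
  have us' : uniq (k :: s) by rewrite /= ks'.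
  have FE : F = \bigcap_(i in [set` s]) (Ys i @^-1` B' i).
    apply: eq_bigcapr => i /= si; rewrite /B'.
    by case: eqP ks' => // <-; rewrite si.
  have BE : B1 = B' k by rewrite /B' eqxx.
  rewrite {1}FE {1}BE -bigcap_cons_preimage IH //; last first.
    rewrite /= leqnn /=; apply: sub_all ks => i; exact: ltnW.
  congr (_ * _)%E.
  by rewrite indep // big_cons -BE FE indep.
have pairk A1 B1 : measurable A1 -> measurable B1 ->
    P (partial_sum Ys k @^-1` A1 `&` Ys k @^-1` B1) =
    (P (partial_sum Ys k @^-1` A1) * P (Ys k @^-1` B1))%E.
  move=> mA1 mB1.
  have := IH [:: k] (fun=> B1) isT _ (fun=> mB1) A1 mA1.
  by rewrite /= leqnn set_cons1 bigcap_set1 => ->.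
have sumE : partial_sum Ys k.+1 @^-1` A =
    (fun t => (partial_sum Ys k t, Ys k t)) @^-1`
      ((fun p : R * R => p.1 + p.2) @^-1` A).
  by apply/seteqP; split=> t /=; rewrite partial_sumS.
rewrite sumE; apply: pair_indep_event => //.
- exact: measurable_partial_sum.
- by move=> A1 B1 mA1 mB1; rewrite -setIA split_event // pairk // muleA.
- rewrite -[X in measurable X]setTI.
  exact: measurable_funD.
Qed.

Lemma partial_sum_indep_next k : indep_RV (partial_sum Ys k) (Ys k).
Proof.
move=> A B mA mB.
have := @partial_sum_indep_future k [:: k] (fun=> B) isT _ (fun=> mB) A mA.
by rewrite /= leqnn set_cons1 bigcap_set1 => ->.
Qed.

End Independence.

(** * Moments of the partial sums *)

Section Moments.
Context {d : measure_display} {T : measurableType d} {R : realType}.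
Variable P : probability T R.

Lemma momentE (X : T -> R) n :
  moment P X n = fine (\int[P]_t (X t ^+ n)%:E)%E.
Proof. by rewrite /moment unlock. Qed.

Lemma calG_integrable (Y : {RV P >-> R}) n :
  calG Y -> P.-integrable setT (fun t => (Y t ^+ n)%:E).
Proof.
case=> + _ => /(_ n); rewrite unlock => h.
apply/integrableP; split; first by apply/measurable_EFinP; exact: measurable_funX.
by under eq_integral do rewrite /= normrX.
Qed.

End Moments.

Lemma eq_distribution_moment {R : realType}
    {d : measure_display} {T : measurableType d} {P : probability T R}
    {d' : measure_display} {T' : measurableType d'} {P' : probability T' R}
    (Y : {RV P >-> R}) (Z : {RV P' >-> R}) (n : nat) :
  (forall A : set R, measurable A ->
     distribution P' Z A = distribution P Y A) ->
  P.-integrable setT (fun t => (Y t ^+ n)%:E) ->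
  P'.-integrable setT (fun t => (Z t ^+ n)%:E) /\
  moment P' Z n = moment P Y n.
Proof.
move=> ZY iY.
pose f : R -> \bar R := fun x => (x ^+ n)%:E.
have mf : measurable_fun [set: R] f.
  by apply/measurable_EFinP; exact: exprn_measurable.
have mabsf : measurable_fun [set: R] (abse \o f) by exact: measurableT_comp.
have absf_ge0 x : (0 <= (abse \o f) x)%E by exact: abse_ge0.
have iZ : P'.-integrable setT (f \o Z).
  apply/integrableP; split; first exact: measurableT_comp.
  rewrite -(ge0_integral_distribution Z mabsf absf_ge0).
  rewrite (eq_measure_integral (distribution P Y)) => [|A mA _]; last exact: ZY.
  rewrite (ge0_integral_distribution Y mabsf absf_ge0).
  by case/integrableP : iY.
split=> //; rewrite !momentE; congr fine.
rewrite -(integral_distribution (X := Z) mf) //.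
rewrite -(integral_distribution (X := Y) mf) //.
by apply: eq_measure_integral => A mA _; exact: ZY.
Qed.

Section PartialSumMoments.
Context {d : measure_display} {T : measurableType d} {R : realType}.
Variables (P : probability T R) (Ys : nat -> {RV P >-> R}).
Hypothesis indep : mutually_independent Ys.
Hypothesis intY :
  forall i n, P.-integrable setT (fun t => (Ys i t ^+ n)%:E).

Lemma partial_sum_pow_term k n (i : 'I_n.+1) :
  (forall m, P.-integrable setT (fun t => (partial_sum Ys k t ^+ m)%:E)) ->
  P.-integrable setT
    (fun t => (partial_sum Ys k t ^+ (n - i) * Ys k t ^+ i)%:E) /\
  (\int[P]_t (partial_sum Ys k t ^+ (n - i) * Ys k t ^+ i)%:E =
   (moment P (partial_sum Ys k) (n - i) * moment P (Ys k) i)%:E)%E.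
Proof.
move=> iS.
have [iSY ->] := @indep_integral_mul _ _ _ P
  (fun t => partial_sum Ys k t ^+ (n - i)) (fun t => Ys k t ^+ i)
  (indep_RV_comp (exprn_measurable _) (exprn_measurable _)
     (partial_sum_indep_next indep k)) (iS _) (intY k i).
split=> //.
by rewrite !momentE EFinM !fineK//; exact: integrable_fin_num.
Qed.

Lemma partial_sum_powS k n t : (partial_sum Ys k.+1 t ^+ n)%:E =
  (\sum_(i < n.+1) ('C(n, i)%:R%:E *
     (partial_sum Ys k t ^+ (n - i) * Ys k t ^+ i)%:E))%E.
Proof.
by rewrite partial_sumS exprDn -sumEFin; apply: eq_bigr => i _;
  rewrite -EFinM mulr_natl.
Qed.

Lemma integrable_partial_sum_pow k n :
  P.-integrable setT (fun t => (partial_sum Ys k t ^+ n)%:E).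
Proof.
elim: k n => [|k IH] n.
  have -> : (fun t => (partial_sum Ys 0 t ^+ n)%:E) = cst (0 ^+ n)%:E.
    by apply/funext => t; rewrite /partial_sum big_ord0.
  exact: finite_measure_integrable_cst.
under eq_fun do rewrite partial_sum_powS.
apply: integrable_sum => [//|i _]; apply: integrableZl => //.
by case: (partial_sum_pow_term i IH).
Qed.

Lemma moment_partial_sum0 n : moment P (partial_sum Ys 0) n = (n == 0)%:R.
Proof.
rewrite /moment [X in 'E_P[X]%E](_ : _ = cst (n == 0)%:R) ?expectation_cst//.
by apply/funext => t; rewrite /partial_sum big_ord0 expr0n.
Qed.

Lemma moment_partial_sumS k n : moment P (partial_sum Ys k.+1) n =
  \sum_(i < n.+1) 'C(n, i)%:R *
    (moment P (partial_sum Ys k) (n - i) * moment P (Ys k) i).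
Proof.
rewrite momentE; under eq_integral do rewrite partial_sum_powS.
have term i := partial_sum_pow_term i (integrable_partial_sum_pow k).
rewrite integral_sum//; last first.
  by move=> i; apply: integrableZl => //; case: (term n i).
rewrite (eq_bigr (fun i : 'I_n.+1 => ('C(n, i)%:R *
    (moment P (partial_sum Ys k) (n - i) * moment P (Ys k) i))%:E)).
  by rewrite sumEFin.
move=> i _; have [iSY e] := term n i.
by rewrite integralZl// e EFinM.
Qed.

End PartialSumMoments.

End Probability.

(** * Power series coefficients *)

(** The hypothesis is the triangular system [L *m w = delta_mx 0 0], where [L]
    is the lower triangular Toeplitz matrix of [p] and [w] the column of the
    values of [q]. As [\det L = 1], Cramer's rule gives [q N] as the cofactor
    of [L] at row [0] and column [N]; deleting this row and this column shifts
    the diagonal of [L] to the superdiagonal. *)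
Lemma convolution_inverse_det (F : comNzRingType) (p q : nat -> F) (N : nat) :
  p 0%N = 1 ->
  (forall i, (i <= N)%N -> \sum_(j < i.+1) p (i - j)%N * q j = (i == 0)%:R) ->
  q N = (-1) ^+ N *
    \det (\matrix_(i < N, j < N) if (j <= i.+1)%N then p (i.+1 - j)%N else 0).
Proof.
move=> p0 pq.
pose L : 'M[F]_N.+1 := \matrix_(i, j) if (j <= i)%N then p (i - j)%N else 0.
pose w : 'cV[F]_N.+1 := \col_j q j.
have Lw : L *m w = delta_mx 0 0.
  apply/matrixP => i j; rewrite ord1 !mxE eqxx andbT.
  have -> : (i == 0) = (i == 0%N :> nat) by [].
  rewrite -(pq i (leq_ord i)).
  rewrite (big_ord_widen N.+1 (fun j => p (i - j)%N * q j))//.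
  rewrite [RHS]big_mkcond; apply: eq_bigr => k _.
  by rewrite !mxE ltnS; case: ifP; rewrite ?mul0r.
have detL : \det L = 1.
  rewrite det_trig; first by apply: big1 => i _; rewrite mxE leqnn subnn.
  by apply/is_trig_mxP => i j ij; rewrite mxE leqNgt ij.
have adjw : w = \adj L *m delta_mx 0 0.
  by rewrite -Lw mulmxA mul_adj_mx detL mul1mx.
have -> : q N = w ord_max 0 by rewrite mxE.
rewrite adjw -colE !mxE /cofactor add0n; congr (_ * \det _).
apply/matrixP => i j; rewrite !mxE /= /bump leq0n add1n.
by rewrite (leqNgt N j) ltn_ord.
Qed.

Section TruncatedSeries.
Context {F : numFieldType}.
Implicit Types c m : nat -> F.

(** The power series with coefficients [c], without its constant term and
    modulo [X^(N+1)]; working with polynomials is enough as only finitely many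
    coefficients matter. *)
Definition trunc_series c N : {poly F} := \sum_(i < N) c i.+1 *: 'X^(i.+1).

Lemma coef_trunc_series c N k :
  (k <= N)%N -> (trunc_series c N)`_k = if k == 0%N then 0 else c k.
Proof.
move=> kN; rewrite coef_sumMXn; case: k kN => [_|k kN].
  by rewrite big_pred0.
by rewrite (big_pred1 (Ordinal kN)) // => i; rewrite /= eqSS -val_eqE.
Qed.

Lemma coef_trunc_series_addX c N k :
  c 0%N = 1 -> (k <= N)%N -> (1 + trunc_series c N)`_k = c k.
Proof.
move=> c0 kN; rewrite coefD coef1 coef_trunc_series//.
by case: eqP => [->|_]; rewrite ?c0 ?addr0 ?add0r.
Qed.

(** The binomial recursion for [M k.+1 n / n!] is the Cauchy product of
    exponential generating functions. *)
Lemma binomial_convolution_coef m (M : nat -> nat -> F) N :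
  m 0%N = 1 -> (forall n, M 0%N n = (n == 0%N)%:R) ->
  (forall k n, M k.+1 n =
     \sum_(i < n.+1) 'C(n, i)%:R * (M k (n - i)%N * m i)) ->
  forall k n, (n <= N)%N ->
  M k n = n`!%:R * ((1 + trunc_series (fun i => m i / i`!%:R) N) ^+ k)`_n.
Proof.
move=> m0 M0 MS; elim=> [|k IH] n nN.
  by rewrite M0 expr0 coef1; case: eqP => [->|_]; rewrite ?mulr0 ?mulr1.
rewrite MS exprSr coefMr mulr_sumr; apply: eq_bigr => i _.
have le_in : (i <= n)%N by rewrite -ltnS.
rewrite IH ?(leq_trans (leq_subr _ _))//.
rewrite coef_trunc_series_addX ?(leq_trans le_in)//; last by rewrite m0 divr1.
rewrite -(bin_fact le_in) !natrM.
have fi : (i`!%:R : F) != 0 by rewrite pnatr_eq0 -lt0n fact_gt0.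
by field.
Qed.

End TruncatedSeries.

(** The identity [\prod_i exp(x_i t) = exp((\sum_i x_i) t)], compared in
    degree [k]. The exponentials are cut off at degree [K >= k], which makes
    the left-hand side a product of finite sums indexed by ['I_K.+1]. *)
Lemma exp_coef_prod {F : numFieldType} {A : comAlgType F} (I : Type)
    (r : seq I) (x : I -> A) (K k : nat) :
  (k <= K)%N ->
  (\prod_(i <- r) \sum_(l < K.+1) ((l`!%:R : F)^-1 *: x i ^+ l) *: 'X^l)`_k =
  (k`!%:R : F)^-1 *: (\sum_(i <- r) x i) ^+ k.
Proof.
elim: r k => [|i r IH] k kK.
  rewrite !big_nil coef1 expr0n; case: eqP => [->|_]; last by rewrite scaler0.
  by rewrite invr1 scale1r.
rewrite !big_cons coefMr exprDn scaler_sumr; apply: eq_bigr => j _.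
have le_jk : (j <= k)%N by rewrite -ltnS.
have kjK : (k - j < K.+1)%N by rewrite ltnS (leq_trans (leq_subr _ _)).
rewrite IH ?(leq_trans le_jk)// coef_sumMXn (big_pred1 (Ordinal kjK))//.
rewrite -scalerAl -scalerAr scalerA -scalerMnr scalerMnl -mulr_natr /=.
congr (_ *: _).
have fact_neq0 l : (l`!%:R : F) != 0 by rewrite pnatr_eq0 -lt0n fact_gt0.
have : 'C(k, j)%:R != 0 :> F by rewrite pnatr_eq0 -lt0n bin_gt0.
move: (fact_neq0 j) (fact_neq0 (k - j)%N).
by rewrite -(bin_fact le_jk) !natrM => *; field; exact/and3P.
Qed.

(** Distributing the product of truncated exponentials over its sums produces
    one term per function ['I_n -> 'I_K.+1], whose degree is the sum of the
    values of the function; the coefficient of degree [k] is the claim. *)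
Lemma multinomial_theorem {F : numFieldType} {A : comAlgType F} (n K k : nat)
    (x : 'I_n -> A) :
  (k <= K)%N ->
  (k`!%:R : F)^-1 *: (\sum_(i < n) x i) ^+ k =
  \sum_(l : {ffun 'I_n -> 'I_K.+1} | (\sum_(i < n) l i)%N == k)
    \prod_(i < n) (((l i)`!%:R : F)^-1 *: x i ^+ l i).
Proof.
move=> kK; rewrite -(exp_coef_prod _ _ kK) bigA_distr_bigA.
under eq_bigr do rewrite scaler_prod -expr_sum.
by rewrite coef_sumMXn.
Qed.

(** * Coefficients of the geometric sum *)

Section FubiniCoefficients.
Context {F : numFieldType}.
Implicit Types c m : nat -> F.

Lemma coef_trunc_series_exp c N k i :
  (i < k)%N -> (trunc_series c N ^+ k)`_i = 0.
Proof.
move=> ik.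
have -> : trunc_series c N = (\sum_(j < N) c j.+1 *: 'X^j) * 'X.
  by rewrite mulr_suml; apply: eq_bigr => j _; rewrite exprSr scalerAl.
by rewrite exprMn coefMXn ik.
Qed.

(** The error term of the geometric sum is a power [B^(N+1)] of a polynomial
    without constant term, hence invisible up to degree [N]. *)
Lemma coef_geometric_trunc_series c N i : (i <= N)%N ->
  ((1 - trunc_series c N) * \sum_(k < N.+1) trunc_series c N ^+ k)`_i =
  (i == 0%N)%:R.
Proof.
move=> iN; rewrite -opprB mulNr -subrX1 opprB coefB coef1.
by rewrite coef_trunc_series_exp ?subr0.
Qed.

(** The geometric sum is the inverse of [1 - B], so its coefficient of degree
    [n] is a Toeplitz determinant in the coefficients of [1 - B]. *)
Lemma geometric_coef_det m n :
  (\sum_(k < n.+1) trunc_series (fun i => m i / i`!%:R) n ^+ k)`_n =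
  \det (\matrix_(i < n, j < n)
    if (j <= i)%N then (-1) ^+ (i - j) * m (i - j).+1 / ((i - j).+1)`!%:R
    else if j == i.+1 :> nat then 1 else 0).
Proof.
set B := trunc_series _ n; set u := \sum_(k < _) _.
have B0 : B`_0 = 0 by rewrite coef_trunc_series.
(* These are the coefficients after the substitution of [-X] for [X], which
   turns the negative coefficients of [1 - B] into alternating ones. *)
pose p i := (-1) ^+ i * (1 - B)`_i; pose q i := (-1) ^+ i * u`_i.
have p0 : p 0%N = 1 by rewrite /p mul1r coefB coef1 B0 subr0.
have pq i : (i <= n)%N -> \sum_(j < i.+1) p (i - j)%N * q j = (i == 0%N)%:R.
  move=> le_in; transitivity ((-1) ^+ i * ((1 - B) * u)`_i).
    rewrite coefMr mulr_sumr; apply: eq_bigr => j _.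
    by rewrite /p /q mulrACA -exprD subnK // -ltnS.
  rewrite coef_geometric_trunc_series //.
  by case: eqP => [->|_]; rewrite ?mulr0 ?mulr1.
have -> : u`_n = (-1) ^+ n * q n.
  by rewrite /q mulrA -exprMn mulrNN mul1r expr1n mul1r.
rewrite (convolution_inverse_det p0 pq) mulrA -exprMn mulrNN mul1r expr1n mul1r.
congr (\det _); apply/matrixP => i j; rewrite !mxE.
case: (ltngtP j i.+1) => [ji|ij|ji].
- rewrite -ltnS ji subSn // /p coefB coef1 sub0r coef_trunc_series /=; last first.
    by rewrite (leq_ltn_trans (leq_subr _ _)).
  by rewrite exprS mulN1r mulrNN mulrA.
- by rewrite leqNgt (ltn_trans (ltnSn i) ij).
- by rewrite ji ltnn subnn p0.
Qed.

(** In the expansion of [B^k] the exponent vector [l] with [\sum_i l i = k]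
    contributes to the degree [\sum_i i.+1 * l i] only, since [c i.+1] comes
    with ['X^(i.+1)]; the factor [k!] of the multinomial coefficient becomes
    [(\sum_i l i)!] once the sum over [k] is carried out. *)
Lemma geometric_coef_multinomial c n :
  (\sum_(k < n.+1) trunc_series c n ^+ k)`_n =
  \sum_(l : {ffun 'I_n -> 'I_n.+1} | (\sum_(i < n) i.+1 * l i)%N == n)
    (\sum_(i < n) l i)%N`!%:R / (\prod_(i < n) (l i)`!%:R) *
    \prod_(i < n) c i.+1 ^+ l i.
Proof.
pose G (l : {ffun 'I_n -> 'I_n.+1}) : F :=
  \prod_(i < n) (((l i)`!%:R)^-1 * c i.+1 ^+ l i).
have powE (k : 'I_n.+1) : (trunc_series c n ^+ k)`_n =
    \sum_(l : {ffun 'I_n -> 'I_n.+1} | ((\sum_(i < n) l i)%N == k) &&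
       ((\sum_(i < n) i.+1 * l i)%N == n)) k`!%:R * G l.
  have fk : (k`!%:R : F) != 0 by rewrite pnatr_eq0 -lt0n fact_gt0.
  rewrite -[trunc_series c n ^+ k](scalerKV fk).
  rewrite (multinomial_theorem _ (leq_ord k)) coefZ -mulr_sumr; congr (_ * _).
  rewrite (eq_bigr (fun l => G l *: 'X^(\sum_(i < n) i.+1 * l i)%N)).
    by rewrite coef_sumMXn.
  move=> l _; rewrite expr_sum -scaler_prod; apply: eq_bigr => i _.
  by rewrite exprZn scalerA exprM.
rewrite coef_sum (eq_bigr _ (fun k _ => powE k)).
rewrite (exchange_big_dep (fun l : {ffun 'I_n -> 'I_n.+1} =>
  (\sum_(i < n) i.+1 * l i)%N == n)) => [|k l _ /andP[]//].
apply: eq_bigr => l /eqP ln.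
(* Every weight [i.+1] is at least [1], so [\sum_i l i <= n] is itself one of
   the indices [k] of the geometric sum, the only one to which [l] contributes. *)
have sum_le : (\sum_(i < n) l i < n.+1)%N.
  by rewrite ltnS -[leqRHS]ln; apply: leq_sum => i _; rewrite leq_pmull.
rewrite (big_pred1 (Ordinal sum_le)) => [|k]; last first.
  by rewrite /= ln eqxx andbT -val_eqE eq_sym.
by rewrite /G big_split /= prodfV mulrA.
Qed.

End FubiniCoefficients.

(** * Probabilistic Fubini numbers *)

(** With [B] the truncated series, the alternating sum over [j] that defines the
    Stirling number is the binomial expansion of [B^k = ((1 + B) - 1)^k]. *)
Lemma prob_fubini_coef {R : realType}
    {d : measure_display} {T : measurableType d} {P : probability T R}
    {d' : measure_display} {T' : measurableType d'} {P' : probability T' R}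
    (Y : {RV P >-> R}) (Ys : nat -> {RV P' >-> R}) (n : nat) :
  calG Y -> iid_copies Y Ys ->
  prob_fubini Ys n = n`!%:R *
    (\sum_(k < n.+1)
       trunc_series (fun i => moment P Y i / i`!%:R) n ^+ k)`_n.
Proof.
move=> GY [indep distYs].
have YsY i m := eq_distribution_moment (distYs i) (calG_integrable m GY).
have intYs i m := (YsY i m).1.
have m0 : moment P Y 0 = 1.
  by rewrite /moment [X in 'E_P[X]%E](_ : _ = cst 1) ?expectation_cst.
have MS k m : moment P' (partial_sum Ys k.+1) m = \sum_(i < m.+1) 'C(m, i)%:R *
    (moment P' (partial_sum Ys k) (m - i) * moment P Y i).
  rewrite (moment_partial_sumS indep intYs).
  by apply: eq_bigr => i _; rewrite (YsY k i).2.
have M_coef := @binomial_convolution_coef _ (moment P Y)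
  (fun k => moment P' (partial_sum Ys k)) n m0 (moment_partial_sum0 Ys) MS.
rewrite coef_sum mulr_sumr; apply: eq_bigr => k _.
set B := trunc_series _ n.
have fk : (k`!%:R : R) != 0 by rewrite pnatr_eq0 -lt0n fact_gt0.
rewrite /prob_stirling2 mulrC mulVKf //.
have -> : B = -1 + (1 + B) by rewrite addKr.
rewrite exprDn coef_sum mulr_sumr; apply: eq_bigr => j _.
rewrite (M_coef j n (leqnn n)) -/B coefMn -mulr_natl.
have -> : ((-1) ^+ (k - j) : {poly R}) = ((-1) ^+ (k - j))%:P.
  by rewrite polyC_exp polyCN.
by rewrite coefCM; ring.
Qed.

Unset Implicit Arguments.

(* [l i] stands for l_(i+1); the constraint forces every l_i to be at most n,
   so nothing is lost by letting l range over functions into 'I_n.+1. *)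
Theorem theorem5p2 (R : realType)
    (d : measure_display) (T : measurableType d) (P : probability T R)
    (d' : measure_display) (T' : measurableType d') (P' : probability T' R)
    (Y : {RV P >-> R}) (Ys : nat -> {RV P' >-> R})
    (hY : calG Y) (hYs : iid_copies Y Ys) (n : nat) (hn : (1 <= n)%N) :
  prob_fubini Ys n = n`!%:R * \det (fubini_matrix (moment P Y) n)
  /\
  prob_fubini Ys n =
    n`!%:R *
    \sum_(l : {ffun 'I_n -> 'I_n.+1} | (\sum_(i < n) i.+1 * l i)%N == n)
      multinomial R (fun i => l i : nat) *
      \prod_(i < n) (moment P Y i.+1 / (i.+1)`!%:R) ^+ l i.
Proof.
rewrite (prob_fubini_coef n hY hYs); split; congr (_ * _).
  exact: geometric_coef_det.
exact: geometric_coef_multinomial.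
Qed.
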